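(* Let $G$ be any graph and let $a,b,s,t$ be vertices of $G$ with $s\neq t$. In the random orientation model $O$, conditioned on the event $\{t\notin \overrightarrow{C}_s\}$, the events $\{a\in \overleftarrow{C}_t\}$ and $\{b\in \overrightarrow{C}_s\}$ are negatively correlated, that is, \[P_{O}\big(a\in \overleftarrow{C}_t,\ b\in \overrightarrow{C}_s \,\big|\, t\notin \overrightarrow{C}_s \big)\ \le\ P_{O}\big(a\in \overleftarrow{C}_t \,\big|\, t\notin \overrightarrow{C}_s \big)\,P_{O}\big(b\in \overrightarrow{C}_s \,\big|\, t\notin \overrightarrow{C}_s \big).\]
   Context: $G$ is a fixed undirected graph with vertex set $V(G)$. Model $O$ (random orientation): every edge of $G$ is directed in one of its two possible directions, each with probability $1/2$, independently of all other edges. $P_O$ denotes probability in this model. For a vertex $v$, the out-cluster $\overrightarrow{C}_v=\overrightarrow{C}_v(G)\subseteq V(G)$ is the random set of all vertices $u$ for which there is a directed path from $v$ to $u$, and the in-cluster $\overleftarrow{C}_v=\overleftarrow{C}_v(G)\subseteq V(G)$ is the random set of all vertices $u$ for which there is a directed path from $u$ to $v$. By convention $v\in\overleftarrow{C}_v\cap\overrightarrow{C}_v$. *)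

(* Defs.v *)
From HB Require Import structures.
From mathcomp Require Import all_boot all_order all_algebra.
From mathcomp Require Import all_classical all_reals all_analysis.

Set Implicit Arguments.
Unset Strict Implicit.
Unset Printing Implicit Defensive.

Import Order.TTheory GRing.Theory Num.Theory.
Local Open Scope classical_set_scope.
Local Open Scope ring_scope.

(* A graph on V is a symmetric irreflexive relation [e]. An orientation of it
   is a relation [o], where [o u v] means that the edge uv is directed from u
   to v. *)
Definition orientation (V : Type) (e o : rel V) : Prop :=
  (forall u v, o u v -> e u v) /\
  (forall u v, e u v -> o u v = ~~ o v u).

Definition directed_path (V : eqType) (o : rel V) (u v : V) : Prop :=
  exists p : seq V, [/\ path o u p, uniq (u :: p) & last u p = v].

Definition out_cluster (V : eqType) (o : rel V) (v : V) : set V :=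
  [set u | directed_path o v u].

Definition in_cluster (V : eqType) (o : rel V) (v : V) : set V :=
  [set u | directed_path o u v].

Definition arc_event (T : Type) (V : Type) (O : T -> rel V) (a : V * V) :
  set T := [set w | O w a.1 a.2].

(* A list of arcs of the graph that uses every edge at most once, i.e. a
   choice of directions for finitely many distinct edges. *)
Definition partial_orientation (V : eqType) (e : rel V) (s : seq (V * V)) :
  Prop :=
  [/\ uniq s, {in s, forall a, e a.1 a.2} &
      {in s, forall a, (a.2, a.1) \notin s}].

(* Since each edge has only two directions, the product rule over the choices
   of directions for finitely many distinct edges is the mutual independence
   of the directions of all the edges. *)
Definition random_orientation (R : realType) (d : measure_display)
    (T : measurableType d) (P : probability T R) (V : eqType) (e : rel V)
    (O : T -> rel V) : Prop :=
  [/\ forall w, orientation e (O w),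
      forall u v, measurable (arc_event O (u, v)),
      forall u v, e u v -> P (arc_event O (u, v)) = (2^-1)%:E &
      forall s, partial_orientation e s ->
        P (\bigcap_(a in [set` s]) arc_event O a) =
        (\prod_(a <- s) P (arc_event O a))%E].

(* The value is 0 when [P B = 0]. For [B] the event that t is not in the
   out-cluster of s, with s <> t, this can only happen on an infinite graph. *)
Definition cond_prob (R : realType) (d : measure_display)
    (T : measurableType d) (P : probability T R) (A B : set T) : R :=
  fine (P (A `&` B)) / fine (P B).

(* Main.v *)
Require Import Defs.
From HB Require Import structures.
From mathcomp Require Import all_boot all_order all_algebra.
From mathcomp Require Import all_classical all_reals all_analysis.
From mathcomp Require Import zify ring lra.
Set Implicit Arguments.
Unset Strict Implicit.
Unset Printing Implicit Defensive.
Import Order.TTheory GRing.Theory Num.Theory.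
Import numFieldNormedType.Exports.
Local Open Scope classical_set_scope.
Local Open Scope ring_scope.

(** For two sets of vertices S and T, let D be the event that no directed path
leads from S to T. The inequality is an instance of a positive correlation
statement: given D, any two functions of the pair (set reached from S, set
reaching T) that increase with the first set and decrease with the second are
positively correlated ([clusters_positively_correlated]). The theorem follows
by taking the indicator of b being reached from s and minus the indicator of a
reaching t.

On a finite list of edges this is proved by induction on the number of edges,
for all S and T at once. Suppose that the edge uv has u in S, and reveal its
direction. If it points from u to v, then v joins S; if it points to u, the
edge is useless: S already contains u, and given D no path to T visits u. In
both cases we are left with the same problem on the remaining edges, started
from S + v or from S ([separated_sum_explore]). The induction hypothesis
handles each of the two cases, so it remains to see that the two conditional
means given the direction of uv are ordered in the same way for both functions
(a two-point Chebyshev inequality, [two_point_correlation]). They are: on the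
remaining edges, the event D for S + v is the event D for S together with the
event that v does not reach T. The indicator of the latter decreases with the
set reaching T, so by the induction hypothesis conditioning on it increases the
mean of a monotone function; replacing the set reached from S by the larger set
reached from S + v increases it again. An edge touching T is treated in the
same way after reversing all arcs, and when no edge touches S or T both sets
are deterministic.

The law of the orientation restricted to finitely many edges is uniform by the
product rule ([local_probability]), so the finite inequality is one between
probabilities. A countable graph is exhausted by the finite graphs spanned by
its first n vertices: the connection events of these increase to those of the
whole graph, the event D decreases, and the probabilities converge
([cvg_probability_cup_cap]). *)

(** * Reachability *)

Section Reachability.
Context {V : eqType}.
Implicit Types (o : rel V) (S T X : set V) (u v w : V).

Lemma directed_path_refl o u : directed_path o u u.
Proof. by exists [::]. Qed.

Lemma path_directed_path o u p : path o u p -> directed_path o u (last u p).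
Proof. by case/shortenP=> p' pp' up' _; exists p'. Qed.

Lemma directed_path_trans o u v w :
  directed_path o u v -> directed_path o v w -> directed_path o u w.
Proof.
move=> [p [pp _ <-]] [q [pq _ <-]]; rewrite -last_cat.
by apply: path_directed_path; rewrite cat_path pp.
Qed.

Lemma directed_path1 o u v : o u v -> directed_path o u v.
Proof. by move=> ouv; apply: (@path_directed_path o u [:: v]); rewrite /= ouv. Qed.

(** Reachability is the smallest relation closed under the arcs; this induction
principle spares any manipulation of explicit paths below. *)
Lemma closed_directed_path o X u v :
    (forall x y, o x y -> X x -> X y) -> directed_path o u v -> X u -> X v.
Proof.
move=> Xo [p [pp _ <-]]; elim: p u pp => //= y p IHp u /andP[ouy pp] Xu.
exact: IHp pp (Xo _ _ ouy Xu).
Qed.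

Lemma sub_directed_path o o' u v :
  subrel o o' -> directed_path o u v -> directed_path o' u v.
Proof.
by move=> oo' [p [pp up vp]]; exists p; split=> //; apply: sub_path pp.
Qed.

Definition reverse o : rel V := fun u v => o v u.

Lemma directed_path_reverse o u v :
  directed_path (reverse o) u v <-> directed_path o v u.
Proof.
have rev o' x y : directed_path o' x y -> directed_path (reverse o') y x.
  move=> p; pose X := [set z | directed_path (reverse o') z x].
  apply: (@closed_directed_path o' X x y) => // [z z' o'z|].
    by apply: directed_path_trans; apply: directed_path1.
  exact: directed_path_refl.
by split=> /rev.
Qed.

Definition reach_from o S : set V := [set v | exists2 u, S u & directed_path o u v].
Definition reach_to o T : set V := [set u | exists2 v, T v & directed_path o u v].

Definition separated o S T : bool := `[< reach_from o S `&` T = set0 >].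

Lemma separatedP o S T :
  reflect (forall u v, S u -> T v -> ~ directed_path o u v) (separated o S T).
Proof.
apply: (iffP (asboolP _)) => [ST0 u v Su Tv uv | ST].
  by suff: set0 v by []; rewrite -ST0; split=> //; exists u.
by apply/seteqP; split=> // v [[u Su uv] Tv]; case: (ST u v).
Qed.

Lemma reach_from_reverse o S : reach_from (reverse o) S = reach_to o S.
Proof.
by apply/seteqP; split=> v [u Su uv]; exists u => //; apply/directed_path_reverse.
Qed.

Lemma reach_to_reverse o T : reach_to (reverse o) T = reach_from o T.
Proof.
by apply/seteqP; split=> v [u Su uv]; exists u => //; apply/directed_path_reverse.
Qed.

Lemma separated_reverse o S T : separated (reverse o) T S = separated o S T.
Proof.
apply/separatedP/separatedP => H u v uS vT uv; apply: (H v u) => //;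
  exact/directed_path_reverse.
Qed.

Lemma reach_from_least o S X : S `<=` X ->
  (forall x y, o x y -> X x -> X y) -> reach_from o S `<=` X.
Proof.
by move=> SX Xo v [u /SX Xu uv]; apply: (closed_directed_path Xo uv).
Qed.

Lemma reach_to_least o T X : T `<=` X ->
  (forall x y, o x y -> X y -> X x) -> reach_to o T `<=` X.
Proof.
move=> TX Xo; rewrite -reach_from_reverse; apply: reach_from_least => // x y.
exact: Xo.
Qed.

Lemma sub_reach_from o S : S `<=` reach_from o S.
Proof. by move=> u Su; exists u => //; apply: directed_path_refl. Qed.

Lemma sub_reach_to o T : T `<=` reach_to o T.
Proof. by move=> u Su; exists u => //; apply: directed_path_refl. Qed.

Lemma reach_from_closed o S x y : o x y -> reach_from o S x -> reach_from o S y.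
Proof.
move=> oxy [u Su ux]; exists u => //.
by apply: directed_path_trans ux _; apply: directed_path1.
Qed.

Lemma reach_to_closed o T x y : o x y -> reach_to o T y -> reach_to o T x.
Proof.
move=> oxy [u Tu yu]; exists u => //.
by apply: directed_path_trans yu; apply: directed_path1.
Qed.

Lemma separated_reach_to o S T u : separated o S T -> S u -> ~ reach_to o T u.
Proof. by move=> /separatedP ST Su [v Tv]; apply: ST. Qed.

(** Adding a vertex v to S costs exactly the event that v does not reach T,
which depends only on the set reaching T. *)
Lemma separatedU1 o S T v :
  separated o (v |` S) T = separated o S T && `[< ~ reach_to o T v >].
Proof.
apply/separatedP/andP => [ST | [/separatedP ST /asboolP vT] u w [-> | Su] Tw uw].
- split; last by apply/asboolP => -[w Tw]; apply: ST => //; left.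
  by apply/separatedP=> u w Su; apply: ST; right.
- by apply: vT; exists w.
- exact: ST uw.
Qed.

End Reachability.

(** * Exploring the orientations of a finite list of edges *)

Section Orientations.
Context {V : eqType}.
Implicit Types (o : rel V) (S T : set V) (u v : V) (x : V * V) (l : seq (V * V)).

Definition flip x := (x.2, x.1).

Definition add_arc x o : rel V := fun u v => ((u, v) == x) || o u v.

Lemma flipK : involutive flip.
Proof. by case. Qed.

(** An element of [l] stands for an undirected edge, listed with either of its
two directions. *)
Fixpoint orientations l : seq (rel V) :=
  if l is x :: l' then
    map (add_arc x) (orientations l') ++ map (add_arc (flip x)) (orientations l')
  else [:: fun _ _ => false].

Lemma reverse_add_arc x o : reverse (add_arc x o) = add_arc (flip x) (reverse o).
Proof.
apply/funext=> u; apply/funext=> v; rewrite /reverse /add_arc; case: x => x y.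
by rewrite !xpair_eqE andbC.
Qed.

Lemma add_arcCA x y o : add_arc x (add_arc y o) = add_arc y (add_arc x o).
Proof. by apply/funext=> u; apply/funext=> v; rewrite /add_arc orbCA. Qed.

(** Since u already belongs to S, an arc uv does no more than adding v to the
set of sources. *)
Lemma reach_from_add_arc_out o S u v : S u ->
  reach_from (add_arc (u, v) o) S = reach_from o (v |` S).
Proof.
move=> Su; apply/seteqP; split.
  apply: reach_from_least => [w Sw | x y /orP[/eqP[_ ->] _ |]].
  - by apply: sub_reach_from; right.
  - by apply: sub_reach_from; left.
  - exact: reach_from_closed.
apply: reach_from_least => [w [-> | Sw] | x y oxy].
- apply: (@reach_from_closed _ _ _ u); first by rewrite /add_arc eqxx.
  exact: sub_reach_from.
- exact: sub_reach_from.
- by apply: reach_from_closed; rewrite /add_arc oxy orbT.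
Qed.

Lemma reach_from_add_arc_in o S u v : S u ->
  reach_from (add_arc (v, u) o) S = reach_from o S.
Proof.
move=> Su; apply/seteqP; split; apply: reach_from_least => [|x y].
- exact: sub_reach_from.
- move=> /orP[/eqP[_ ->] _ |]; first exact: sub_reach_from.
  exact: reach_from_closed.
- exact: sub_reach_from.
- by move=> oxy; apply: reach_from_closed; rewrite /add_arc oxy orbT.
Qed.

(** An arc uv matters for reaching T only when v reaches T. *)
Lemma reach_to_add_arc o T u v : ~ reach_to o T v ->
  reach_to (add_arc (u, v) o) T = reach_to o T.
Proof.
move=> Tv; apply/seteqP; split; apply: reach_to_least => [|x y].
- exact: sub_reach_to.
- by move=> /orP[/eqP[_ ->] /Tv // |]; apply: reach_to_closed.
- exact: sub_reach_to.
- by move=> oxy; apply: reach_to_closed; rewrite /add_arc oxy orbT.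
Qed.

Context {R : realDomainType}.
Implicit Types (F : rel V -> R) (f g : set V -> set V -> R).

Lemma sum_orientations_cons x l F :
  \sum_(o <- orientations (x :: l)) F o =
  \sum_(o <- orientations l) F (add_arc x o) +
  \sum_(o <- orientations l) F (add_arc (flip x) o).
Proof. by rewrite big_cat !big_map. Qed.

Lemma sum_orientations_flip x l F :
  \sum_(o <- orientations (flip x :: l)) F o =
  \sum_(o <- orientations (x :: l)) F o.
Proof. by rewrite !sum_orientations_cons addrC flipK. Qed.

(** The edges may be explored in any order, so the next one to be revealed can
be chosen to touch S or T. *)
Lemma sum_orientations_mid l1 x l2 F :
  \sum_(o <- orientations (l1 ++ x :: l2)) F o =
  \sum_(o <- orientations (x :: l1 ++ l2)) F o.
Proof.
elim: l1 F => // y l1 IHl F.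
rewrite cat_cons sum_orientations_cons !IHl !sum_orientations_cons addrACA.
by congr (_ + _ + (_ + _)); apply: eq_bigr => o _; rewrite add_arcCA.
Qed.

(** Reversing all arcs preserves the uniform measure on orientations and
exchanges the roles of S and T. *)
Lemma sum_orientations_reverse l F :
  \sum_(o <- orientations l) F (reverse o) = \sum_(o <- orientations l) F o.
Proof.
elim: l F => [|x l IHl] F; first by rewrite !big_seq1.
rewrite !sum_orientations_cons addrC.
by congr (_ + _); rewrite -[RHS]IHl; apply: eq_bigr => o _;
  rewrite reverse_add_arc ?flipK.
Qed.

(** The unnormalised conditional mean of [f] given that S does not reach T. *)
Definition separated_sum l S T f : R :=
  \sum_(o <- orientations l | separated o S T) f (reach_from o S) (reach_to o T).

Lemma separated_sum_mid l1 x l2 S T f :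
  separated_sum (l1 ++ x :: l2) S T f = separated_sum (x :: l1 ++ l2) S T f.
Proof.
by rewrite /separated_sum big_mkcond sum_orientations_mid -big_mkcond.
Qed.

Lemma separated_sum_flip x l S T f :
  separated_sum (flip x :: l) S T f = separated_sum (x :: l) S T f.
Proof.
by rewrite /separated_sum big_mkcond sum_orientations_flip -big_mkcond.
Qed.

Lemma separated_sum_reverse l S T f :
  separated_sum l S T f = separated_sum l T S (fun X Y => f Y X).
Proof.
rewrite /separated_sum big_mkcond -sum_orientations_reverse -big_mkcond.
apply: eq_big => [ o | o _]; first exact: separated_reverse.
by rewrite reach_from_reverse reach_to_reverse.
Qed.

(** Given separation from T, the endpoint u in S and, when the arc points to v,
also v cannot reach T. So the set reaching T is the same with or without the
edge uv, whatever its direction, and only the set of sources changes. *)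
Lemma separated_sum_explore u v l S T f : S u ->
  separated_sum ((u, v) :: l) S T f =
  separated_sum l (v |` S) T f + separated_sum l S T f.
Proof.
move=> Su; rewrite /separated_sum big_mkcond sum_orientations_cons -!big_mkcond /=.
have sep_out o : separated (add_arc (u, v) o) S T = separated o (v |` S) T.
  by rewrite /separated reach_from_add_arc_out.
have sep_in o : separated (add_arc (v, u) o) S T = separated o S T.
  by rewrite /separated reach_from_add_arc_in.
congr (_ + _); apply: eq_big => // o.
- rewrite sep_out => /separated_reach_to sep_o.
  by rewrite reach_from_add_arc_out // reach_to_add_arc //; apply: sep_o; left.
- rewrite sep_in => /separated_reach_to sep_o.
  by rewrite reach_from_add_arc_in // reach_to_add_arc //; apply: sep_o.
Qed.

Definition cluster_monotone f :=
  forall X X' Y Y', X `<=` X' -> Y' `<=` Y -> f X Y <= f X' Y'.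

Definition avoids v (X Y : set V) : R := (`[< ~ Y v >])%:R.

Lemma avoids_monotone v : cluster_monotone (avoids v).
Proof.
move=> X X' Y Y' _ YY; rewrite /avoids ler_nat.
by case: asboolP => // vY; rewrite asboolT // => /YY.
Qed.

Lemma separated_sum_ge0 l S T f : (forall X Y, 0 <= f X Y) ->
  0 <= separated_sum l S T f.
Proof. by move=> f0; apply: sumr_ge0. Qed.

(** The degenerate case where separation is impossible, for instance when S and
T meet: then there is nothing to average. *)
Lemma separated_sum_eq0 l S T f :
  separated_sum l S T (fun _ _ => 1) = 0 -> separated_sum l S T f = 0.
Proof.
rewrite /separated_sum.
pose K (x y : R) := 0 <= x /\ (x = 0 -> y = 0).
suff: K (\sum_(o <- orientations l | separated o S T) 1)
    (\sum_(o <- orientations l | separated o S T)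
       f (reach_from o S) (reach_to o T)) by case.
apply: (big_ind2 K) => [|x1 x2 y1 y2 [x0 K1] [y0 K2]|o _]; rewrite /K //.
- split=> [|xy0]; first exact: addr_ge0.
  by rewrite K1 ?K2 ?add0r //; lra.
- by split=> [|/eqP]; rewrite ?ler01 ?oner_eq0.
Qed.

Lemma separated_sum_avoids v l S T :
  separated_sum l S T (avoids v) = separated_sum l (v |` S) T (fun _ _ => 1).
Proof.
rewrite /separated_sum [LHS]big_mkcond [RHS]big_mkcond; apply: eq_bigr => o _.
by rewrite separatedU1 /avoids; case: separated => //=; case: asboolP.
Qed.

(** On the separation event for S + v, the only change from S to S + v is that
the reached set grows, which can only increase [f]. *)
Lemma le_separated_sum_avoids v l S T f : cluster_monotone f ->
  separated_sum l S T (fun X Y => f X Y * avoids v X Y) <=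
  separated_sum l (v |` S) T f.
Proof.
move=> fmon; rewrite /separated_sum [leLHS]big_mkcond [leRHS]big_mkcond.
apply: ler_sum => o _; rewrite separatedU1 /avoids.
case: separated => //=; case: asboolP => _; rewrite ?mulr0 // mulr1.
apply: fmon => // w [u Su uw]; exists u => //; by right.
Qed.

(** With index 1 and 0 for the two directions of the revealed edge, [q] is the
mass of the conditioning event and [f], [g], [a] are the sums of two functions
and of their product. The products are positively correlated for each index
and the means [f1 / q1], [g1 / q1] dominate [f0 / q0], [g0 / q0], hence the
products are positively correlated on the whole. *)
Lemma two_point_correlation (a0 a1 f0 f1 g0 g1 q0 q1 : R) :
    0 <= q0 -> 0 <= q1 ->
    (q0 = 0 -> [/\ a0 = 0, f0 = 0 & g0 = 0]) ->
    (q1 = 0 -> [/\ a1 = 0, f1 = 0 & g1 = 0]) ->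
    f0 * g0 <= a0 * q0 -> f1 * g1 <= a1 * q1 ->
    f0 * q1 <= f1 * q0 -> g0 * q1 <= g1 * q0 ->
  (f1 + f0) * (g1 + g0) <= (a1 + a0) * (q1 + q0).
Proof.
rewrite le_eqVlt => /predU1P[<- _ [//|-> -> ->] _ _ | q0_gt0].
  by rewrite !addr0.
rewrite le_eqVlt => /predU1P[<- _ [//|-> -> ->] | q1_gt0 _ _ a0P a1P fP gP].
  by rewrite !add0r.
(* After multiplication by [q0 * q1], the difference of the two sides is the
   Chebyshev term plus nonnegative multiples of the two hypotheses on [a]. *)
rewrite -(ler_pM2r (mulr_gt0 q0_gt0 q1_gt0)).
have fgP : 0 <= (f1 * q0 - f0 * q1) * (g1 * q0 - g0 * q1).
  by rewrite mulr_ge0 ?subr_ge0.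
have b0P : 0 <= (a0 * q0 - f0 * g0) * (q1 * (q1 + q0)).
  by rewrite mulr_ge0 ?subr_ge0 // mulr_ge0 ?addr_ge0 // ltW.
have b1P : 0 <= (a1 * q1 - f1 * g1) * (q0 * (q1 + q0)).
  by rewrite mulr_ge0 ?subr_ge0 // mulr_ge0 ?addr_ge0 // ltW.
rewrite -subr_ge0.
apply: le_trans (addr_ge0 (addr_ge0 b0P b1P) fgP) _.
rewrite le_eqVlt; apply/orP; left; apply/eqP; ring.
Qed.

(** Positive correlation given separation, with denominators cleared so that no
positivity assumption is needed. *)
Definition positively_correlated l S T := forall f g,
  cluster_monotone f -> cluster_monotone g ->
  separated_sum l S T f * separated_sum l S T g <=
  separated_sum l S T (fun X Y => f X Y * g X Y) *
  separated_sum l S T (fun _ _ => 1).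

(** The inductive step. The hypothesis is used for S and S + v to compare the
product with the two factors, and once more for S with the function
[avoids v] to order the two conditional means. *)
Lemma positively_correlated_explore u v l S T : S u ->
  (forall S', positively_correlated l S' T) ->
  positively_correlated ((u, v) :: l) S T.
Proof.
move=> Su IHl f g fmon gmon; rewrite !separated_sum_explore //.
have sum1_ge0 S' : 0 <= separated_sum l S' T (fun _ _ => 1).
  exact: separated_sum_ge0.
(* The conditional mean of [h] from S + v dominates the one from S. *)
have vmon h : cluster_monotone h ->
    separated_sum l S T h * separated_sum l (v |` S) T (fun _ _ => 1) <=
    separated_sum l (v |` S) T h * separated_sum l S T (fun _ _ => 1).
  move=> hmon; rewrite -separated_sum_avoids.
  apply: le_trans (IHl S _ _ hmon (@avoids_monotone v)) _.
  by rewrite ler_wpM2r // le_separated_sum_avoids.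
apply: two_point_correlation; rewrite ?IHl ?vmon // => q0;
  by split; apply: separated_sum_eq0.
Qed.

(** Exchanging S and T turns a function that increases with the first set and
decreases with the second into its opposite in this respect; changing the sign
of both functions repairs this without altering their product. *)
Lemma positively_correlated_reverse l S T :
  positively_correlated l T S -> positively_correlated l S T.
Proof.
move=> TS f g fmon gmon.
have opp_mon h : cluster_monotone h -> cluster_monotone (fun X Y => - h Y X).
  by move=> hmon X X' Y Y' XX YY; rewrite lerN2; apply: hmon.
have := TS _ _ (opp_mon _ fmon) (opp_mon _ gmon).
rewrite ![separated_sum l S T _]separated_sum_reverse /separated_sum.
rewrite !sumrN mulrNN; congr (_ <= _ * _).
by apply: eq_bigr => o _; rewrite mulrNN.
Qed.

Lemma orientations_sub l o u v :
  o \in orientations l -> o u v -> (u, v) \in l \/ (v, u) \in l.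
Proof.
elim: l o => [|x l IHl] o /=; first by rewrite inE => /eqP ->.
rewrite mem_cat => /orP[] /mapP[r /IHl rl ->] /orP[/eqP uv | /rl].
- by rewrite uv inE eqxx; left.
- by rewrite !inE => -[|] ->; rewrite orbT; [left | right].
- by rewrite -(flipK x) -uv !inE eqxx; right.
- by rewrite !inE => -[|] ->; rewrite orbT; [left | right].
Qed.

Lemma reach_from_isolated l S o : o \in orientations l ->
  (forall x, x \in l -> ~ (S x.1 \/ S x.2)) -> reach_from o S = S.
Proof.
move=> ol lS; apply/seteqP; split; last exact: sub_reach_from.
apply: reach_from_least => // x y /(orientations_sub ol)[] /lS /= xyS Sx;
  case: xyS; tauto.
Qed.

Lemma reach_to_isolated l T o : o \in orientations l ->
  (forall x, x \in l -> ~ (T x.1 \/ T x.2)) -> reach_to o T = T.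
Proof.
move=> ol lT; apply/seteqP; split; last exact: sub_reach_to.
apply: reach_to_least => // x y /(orientations_sub ol)[] /lT /= xyT Tx;
  case: xyT; tauto.
Qed.

(** Without edges at S and T both clusters are constant, and the correlation
inequality is an equality. *)
Lemma positively_correlated_isolated l S T :
    (forall x, x \in l -> ~ (S x.1 \/ S x.2)) ->
    (forall x, x \in l -> ~ (T x.1 \/ T x.2)) ->
  positively_correlated l S T.
Proof.
move=> lS lT f g _ _.
have const h : separated_sum l S T h = h S T * separated_sum l S T (fun _ _ => 1).
  rewrite /separated_sum mulr_sumr [LHS]big_seq_cond [RHS]big_seq_cond; apply: eq_bigr => o /andP[ol _].
  by rewrite (reach_from_isolated ol lS) (reach_to_isolated ol lT) mulr1.
rewrite (const f) (const g) (const (fun X Y => f X Y * g X Y)) le_eqVlt.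
by apply/orP; left; apply/eqP; ring.
Qed.

Lemma positively_correlated_touching x l S T : S x.1 \/ S x.2 ->
  (forall S', positively_correlated l S' T) -> positively_correlated (x :: l) S T.
Proof.
case: x => u v [Su | Sv] IHl; first exact: positively_correlated_explore.
move=> f g fmon gmon; rewrite -!(separated_sum_flip (u, v)).
exact: positively_correlated_explore.
Qed.

(** Each step removes one edge touching S or T and may enlarge S or T, whence
the induction on the number of edges with S and T arbitrary. *)
Lemma clusters_positively_correlated l S T : positively_correlated l S T.
Proof.
have [n] := ubnP (size l); elim: n => // n IHn in l S T *; rewrite ltnS => ln.
have step x S' T' : x \in l -> S' x.1 \/ S' x.2 -> positively_correlated l S' T'.
  move=> xl; case/splitPr: xl ln => l1 l2; rewrite size_cat /= addnS -size_cat => ln.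
  move=> xS f g fmon gmon; rewrite !separated_sum_mid.
  by apply: positively_correlated_touching => // S''; apply: IHn.
have [[x xl xS] | lS] := pselect (exists2 x, x \in l & S x.1 \/ S x.2).
  exact: step xS.
have [[x xl xT] | lT] := pselect (exists2 x, x \in l & T x.1 \/ T x.2).
  by apply: positively_correlated_reverse; apply: step xT.
by apply: positively_correlated_isolated => x xl; [move=> ? | move=> ?];
  [apply: lS | apply: lT]; exists x.
Qed.

Definition orientation_count l (Q : rel V -> Prop) : R :=
  \sum_(o <- orientations l) (`[< Q o >])%:R.

(** Reaching t is monotone in the wrong direction: the indicator that a reaches
t decreases when the set reaching t shrinks, and it is its opposite that fits
the general correlation inequality. This sign turns positive correlation into
negative correlation. *)
Lemma orientation_count_le l (a b s t : V) :
  orientation_count l (fun o => (directed_path o a t /\ directed_path o s b) /\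
                                ~ directed_path o s t) *
  orientation_count l (fun o => ~ directed_path o s t) <=
  orientation_count l (fun o => directed_path o a t /\ ~ directed_path o s t) *
  orientation_count l (fun o => directed_path o s b /\ ~ directed_path o s t).
Proof.
pose f (X Y : set V) : R := (`[< X b >])%:R.
pose g (X Y : set V) : R := (`[< Y a >])%:R.
have fmon : cluster_monotone f.
  move=> X X' Y Y' XX _; rewrite /f ler_nat.
  by case: asboolP => // /XX bX; rewrite asboolT.
have gmon : cluster_monotone (fun X Y => - g X Y).
  move=> X X' Y Y' _ YY; rewrite /g lerN2 ler_nat.
  by case: asboolP => // /YY aY; rewrite asboolT.
have sep o : separated o [set s] [set t] = `[< ~ directed_path o s t >].
  by apply/separatedP/asboolP => [|Do u v -> ->]; first apply.
have from_s o : `[< reach_from o [set s] b >] = `[< directed_path o s b >].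
  by apply: asbool_equiv_eq; split=> [[_ ->] | Bo] //; exists s.
have to_t o : `[< reach_to o [set t] a >] = `[< directed_path o a t >].
  by apply: asbool_equiv_eq; split=> [[_ ->] | Ao] //; exists t.
have sumE h Q :
    (forall o, h (reach_from o [set s]) (reach_to o [set t]) = (`[< Q o >])%:R) ->
    separated_sum l [set s] [set t] h =
    orientation_count l (fun o => Q o /\ ~ directed_path o s t).
  move=> hQ; rewrite /separated_sum big_mkcond; apply: eq_bigr => o _.
  by rewrite sep asbool_and andbC hQ; case: (asbool (~ _)).
have := clusters_positively_correlated l [set s] [set t] fmon gmon.
rewrite (_ : separated_sum _ _ _ (fun X Y => - g X Y) =
    - separated_sum l [set s] [set t] g); last by rewrite /separated_sum sumrN.
rewrite (_ : separated_sum _ _ _ (fun X Y => f X Y * - g X Y) =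
    - separated_sum l [set s] [set t] (fun X Y => g X Y * f X Y)); last first.
  by rewrite /separated_sum -sumrN; apply: eq_bigr => o _; rewrite mulrN mulrC.
rewrite (sumE f (fun o => directed_path o s b)) => [|o]; last by rewrite -from_s.
rewrite (sumE g (fun o => directed_path o a t)) => [|o]; last by rewrite -to_t.
rewrite (sumE _ (fun o => directed_path o a t /\ directed_path o s b)) => [|o];
  last by rewrite asbool_and -mulnb natrM -from_s -to_t.
rewrite (sumE _ (fun=> True)) => [|o]; last by rewrite asboolT.
set D := orientation_count l (fun o => ~ _).
rewrite (_ : orientation_count l (fun o => True /\ _) = D); last first.
  by apply: eq_bigr => o _; congr (nat_of_bool _)%:R; apply: asbool_equiv_eq; tauto.
by rewrite mulNr mulrN lerN2 mulrC [leRHS]mulrC.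
Qed.

End Orientations.

(** * The law of a random orientation on finitely many edges *)

Section Cylinders.
Context {V : eqType}.
Implicit Types (e o : rel V) (x : V * V) (l r : seq (V * V)).

Lemma set_of_cons x l : [set` x :: l] = x |` [set` l].
Proof.
by apply/seteqP; split=> y; rewrite /= inE;
  [case/predU1P; [left | right] | case=> [-> | ->]; rewrite ?eqxx ?orbT].
Qed.

Definition restrict l o : rel V :=
  fun u v => o u v && (((u, v) \in l) || ((v, u) \in l)).

Lemma restrict_nil o : restrict [::] o = fun _ _ => false.
Proof. by apply/funext=> u; apply/funext=> v; rewrite /restrict andbF. Qed.

Lemma restrict_flip x l o : restrict (flip x :: l) o = restrict (x :: l) o.
Proof.
apply/funext=> u; apply/funext=> v; rewrite /restrict !inE; case: x => a b.
rewrite /flip !xpair_eqE /=; congr (_ && _).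
by case: (u == a); case: (u == b); case: (v == a); case: (v == b);
  rewrite /= ?orbT.
Qed.

Lemma restrict_cons e x l o : orientation e o -> o x.1 x.2 ->
  restrict (x :: l) o = add_arc x (restrict l o).
Proof.
move=> [oe oN] ox; apply/funext=> u; apply/funext=> v; rewrite /restrict /add_arc !inE.
have [ux | nvx] := eqVneq (u, v) x; first by move: ox; rewrite -ux /= => ->.
case: x ox nvx => a b /= oab _.
have [[-> ->] | //] := eqVneq (v, u) (a, b).
by move: (oab); rewrite oN ?oe // => /negPf ->.
Qed.

Lemma partial_orientation_perm e l r :
  perm_eq l r -> partial_orientation e l -> partial_orientation e r.
Proof.
move=> lr [lu le lN]; have lri := perm_mem lr.
split; [by rewrite -(perm_uniq lr) | by move=> x; rewrite -lri; apply: le |].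
by move=> x; rewrite -!lri; apply: lN.
Qed.

Lemma partial_orientation_flip e x l : symmetric e ->
  partial_orientation e (x :: l) -> partial_orientation e (flip x :: l).
Proof.
move=> e_sym [/= /andP[xl lu] le lN].
have [xx flipl] : flip x != x /\ flip x \notin l.
  by have := lN x; rewrite inE eqxx inE negb_or => /(_ isT)/andP[].
split.
- by rewrite /= flipl.
- move=> y; rewrite inE => /predU1P[-> | yl]; first by rewrite e_sym le ?inE ?eqxx.
  by rewrite le // inE yl orbT.
- move=> y; rewrite inE => /predU1P[-> | yl]; rewrite -/(flip _).
    by rewrite flipK inE negb_or eq_sym xx.
  have := lN y; rewrite inE yl orbT => /(_ isT); rewrite -/(flip y) !inE !negb_or.
  move=> /andP[_ ->]; rewrite andbT (can_eq flipK).
  by apply: contraNneq xl => <-.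
Qed.

End Cylinders.

Section Probability.
Context (R : realType) (d : measure_display) (T : measurableType d).
Context (P : probability T R) (V : countType) (e : rel V).
Context (e_sym : symmetric e) (e_irr : irreflexive e).
Context (O : T -> rel V) (HO : random_orientation P e O).
Implicit Types (x : V * V) (l r : seq (V * V)) (Q : rel V -> Prop).

(** The arcs of [r] are those already revealed, the edges of [l] are still
undecided. *)
Definition cylinder r l Q : set T :=
  \bigcap_(a in [set` r]) arc_event O a `&` [set w | Q (restrict l (O w))].

Lemma cylinder_cons r x l Q : e x.1 x.2 ->
  cylinder r (x :: l) Q =
  cylinder (x :: r) l (Q \o add_arc x) `|`
  cylinder (flip x :: r) l (Q \o add_arc (flip x)).
Proof.
case: HO => O_or _ _ _ ex; rewrite /cylinder !set_of_cons !bigcap_setU1.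
apply/seteqP; split=> w /=; have [_ ON] := O_or w.
- move=> [rw]; have [Ox | NOx] := boolP (O w x.1 x.2).
    by rewrite (restrict_cons _ (O_or w) Ox); left.
  have Ofx : O w (flip x).1 (flip x).2 by rewrite /= ON // e_sym.
  by rewrite -restrict_flip (restrict_cons _ (O_or w) Ofx); right.
- case=> -[[Ox rw]].
    by rewrite -(restrict_cons _ (O_or w) Ox).
  by rewrite -(restrict_cons _ (O_or w) Ox) restrict_flip.
Qed.

(** Revealing the edges of [l] one at a time splits a cylinder into two, until
all directions are fixed and the product rule applies; so each orientation of
[l] receives the same probability. *)
Lemma cylinder_probability r l Q : partial_orientation e (r ++ l) ->
  measurable (cylinder r l Q) /\
  P (cylinder r l Q) = (2^-1 ^+ (size r + size l) * orientation_count l Q)%:E.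
Proof.
case: (HO) => O_or O_meas O_half O_prod.
elim: l r Q => [|x l IHl] r Q; last move=> rxl.
  rewrite cats0 addn0 => r_po; rewrite /cylinder /orientation_count big_seq1.
  have -> : [set w | Q (restrict [::] (O w))] = [set w | Q (fun _ _ => false)].
    by apply/seteqP; split=> w /=; rewrite restrict_nil.
  case: asboolP => QF; last first.
    have -> : [set w : T | Q (fun _ _ => false)] = set0 by apply/seteqP; split.
    by rewrite setI0 measure0 mulr0.
  have -> : [set w : T | Q (fun _ _ => false)] = setT by apply/seteqP; split.
  rewrite setIT mulr1.
  split; first by apply: fin_bigcap_measurable => // -[].
  rewrite O_prod //; case: r_po => _ re _.
  rewrite (eq_big_seq (fun=> (2^-1)%:E)) => [|[u v] /re uv]; last exact: O_half.
  by rewrite prodEFin big_const_seq count_predT -Monoid.iteropE.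
have xrl : partial_orientation e (x :: r ++ l).
  by apply: partial_orientation_perm rxl; rewrite perm_catC /= perm_cons perm_catC.
have ex : e x.1 x.2 by case: xrl => _ + _; apply; rewrite mem_head.
have [m1 p1] := IHl (x :: r) (Q \o add_arc x) xrl.
have [m2 p2] := IHl (flip x :: r) (Q \o add_arc (flip x))
  (partial_orientation_flip e_sym xrl).
rewrite cylinder_cons //; split; first exact: measurableU.
rewrite measureU //.
  rewrite addnS [in RHS]/orientation_count sum_orientations_cons mulrDr EFinD.
  by congr (_ + _)%E; [exact: p1 | exact: p2].
apply/seteqP; split=> // w; rewrite /cylinder !set_of_cons !bigcap_setU1 /arc_event /=.
move=> [[[Ox _] _] [[Ofx _] _]]; have [_ ON] := O_or w.
by move: Ox; rewrite ON // Ofx.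
Qed.

Lemma local_probability l Q : partial_orientation e l ->
  measurable [set w | Q (restrict l (O w))] /\
  P [set w | Q (restrict l (O w))] =
    (2^-1 ^+ size l * orientation_count l Q)%:E.
Proof.
move=> l_po; have := @cylinder_probability [::] l Q l_po.
by rewrite /cylinder (_ : [set` [::]] = set0) ?bigcap_set0 ?setTI //; apply/seteqP; split.
Qed.

(** * Exhausting a countable graph *)

Definition first_vertices n : seq V := pmap pickle_inv (iota 0 n).

(** Each edge is listed once, from its vertex of smaller code. *)
Definition first_edges n : seq (V * V) :=
  [seq x <- [seq (u, v) | u <- first_vertices n, v <- first_vertices n] |
    e x.1 x.2 && (pickle x.1 < pickle x.2)%N].

Lemma mem_first_vertices n v : (v \in first_vertices n) = (pickle v < n)%N.
Proof.
rewrite mem_pmap; apply/mapP/idP => [[k] | vn].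
  rewrite mem_iota /= => kn kv; suff -> : pickle v = k by [].
  by have := @pickle_invK V k; rewrite -kv.
by exists (pickle v); rewrite ?mem_iota // pickleK_inv.
Qed.

Lemma mem_first_edges n u v : ((u, v) \in first_edges n) =
  [&& e u v, (pickle u < pickle v)%N & (pickle v < n)%N].
Proof.
rewrite mem_filter -andbA /=; congr (_ && _).
apply/andP/andP => [[uv /allpairsP[[a b] /= [_ bn [_ vb]]]] | [uv vn]].
  by split=> //; rewrite -mem_first_vertices vb.
split=> //; apply/allpairsP; exists (u, v) => /=.
by rewrite !mem_first_vertices vn (ltn_trans uv).
Qed.

Lemma first_edges_partial_orientation n : partial_orientation e (first_edges n).
Proof.
have un : uniq (first_vertices n).
  exact: (pmap_uniq (@pickle_invK V)) (iota_uniq 0 n).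
split=> [|[u v]|[u v]]; last 2 first.
- by rewrite mem_first_edges => /andP[].
- rewrite !mem_first_edges /= => /and3P[_ uv _].
  by rewrite negb_and negb_and -leqNgt (ltnW uv) orbT.
- by apply/filter_uniq/allpairs_uniq => // -[? ?] [? ?].
Qed.

Lemma restrict_first_edges o n u v : orientation e o ->
  restrict (first_edges n) o u v = [&& o u v, (pickle u < n)%N & (pickle v < n)%N].
Proof.
move=> [oe _]; rewrite /restrict !mem_first_edges; case ouv: (o u v) => //=.
have euv := oe _ _ ouv; rewrite (e_sym v) euv /=.
have : pickle u != pickle v.
  by rewrite (inj_eq (pcan_inj pickleK_inv)); apply: contraTneq euv => ->; rewrite e_irr.
case: ltngtP => //= uv _; rewrite ?orbF.
  by rewrite andbC; case: ltnP => //= vn; rewrite (ltn_trans uv).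
by case: ltnP => //= un; rewrite (ltn_trans uv).
Qed.

Lemma directed_path_restrict_le o u v m n : orientation e o -> (m <= n)%N ->
  directed_path (restrict (first_edges m) o) u v ->
  directed_path (restrict (first_edges n) o) u v.
Proof.
move=> o_or mn; apply: sub_directed_path => x y.
rewrite !restrict_first_edges // => /and3P[-> xm ym].
by rewrite (leq_trans xm) // (leq_trans ym).
Qed.

Lemma directed_path_restrict o u v : orientation e o ->
  directed_path o u v <->
  exists n, directed_path (restrict (first_edges n) o) u v.
Proof.
move=> o_or; split=> [uv | [n]]; last first.
  by apply: sub_directed_path => x y; rewrite restrict_first_edges // => /andP[].
pose X := [set x | exists n, directed_path (restrict (first_edges n) o) u x].
apply: (@closed_directed_path _ o X u v) => // [x y oxy [n ux]|]; last first.
  by exists 0%N; apply: directed_path_refl.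
pose m := (n + (pickle x).+1 + (pickle y).+1)%N.
exists m; apply: (@directed_path_trans _ _ _ x).
  by apply: (directed_path_restrict_le o_or _ ux); rewrite /m -addnA leq_addr.
apply: directed_path1; rewrite restrict_first_edges // oxy /= /m.
by apply/andP; split; lia.
Qed.
End Probability.

(** * Passing to the limit *)

Section Limits.
Context (R : realType) (d : measure_display) (T : measurableType d).
Context (P : probability T R).

Lemma fine_probability_le (A B : set T) : measurable A -> measurable B ->
  A `<=` B -> fine (P A) <= fine (P B).
Proof.
move=> mA mB AB; apply: fine_le; rewrite ?fin_num_measure //.
by apply: le_measure; rewrite ?inE.
Qed.

(** The intersections are not monotone, but they are squeezed between those
with the limit of [Y] and those with the limit of [X], which are. *)
Lemma cvg_probability_cup_cap (X Y : (set T)^nat) :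
    (forall n, measurable (X n)) -> (forall n, measurable (Y n)) ->
    (forall m n, (m <= n)%N -> X m `<=` X n) ->
    (forall m n, (m <= n)%N -> Y n `<=` Y m) ->
  (fun n => fine (P (X n `&` Y n))) @ \oo -->
  fine (P (\bigcup_n X n `&` \bigcap_n Y n)).
Proof.
move=> mX mY X_incr Y_decr.
have mXU : measurable (\bigcup_n X n) by apply: bigcupT_measurable.
have mYI : measurable (\bigcap_n Y n) by apply: bigcapT_measurable.
apply: (@squeeze_cvgr _ _ _ _ (fun n => fine (P (X n `&` \bigcap_n Y n)))
  (fun n => fine (P (\bigcup_n X n `&` Y n)))).
- near=> n; apply/andP; split; apply: fine_probability_le;
    try exact: measurableI.
    by apply: setIS => w Yw; apply: Yw.
  by apply: setSI => w Xw; exists n.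
- apply: fine_cvg; rewrite fineK ?fin_num_measure //; last exact: measurableI.
  rewrite setI_bigcupl; apply: nondecreasing_cvg_mu => [n||m n mn].
  + exact: measurableI.
  + by rewrite -setI_bigcupl; apply: measurableI.
  + by apply/subsetPset; apply: setSI; exact: X_incr mn.
- apply: fine_cvg; rewrite fineK ?fin_num_measure //; last exact: measurableI.
  have capE : \bigcup_n X n `&` \bigcap_n Y n = \bigcap_n (\bigcup_n X n `&` Y n).
    apply/seteqP; split=> [w [Xw Yw] n _ | w XYw]; first by split=> //; apply: Yw.
    by split=> [|n _]; [case: (XYw 0%N I) | case: (XYw n I)].
  rewrite capE; apply: nonincreasing_cvg_mu => [|n||m n mn].
  + by rewrite ltey_eq fin_num_measure //; apply: measurableI.
  + exact: measurableI.
  + by rewrite -capE; apply: measurableI.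
  + by apply/subsetPset; apply: setIS; exact: Y_decr mn.
Unshelve. all: by end_near. Qed.

End Limits.

Theorem theorem3p6 (R : realType) (d : measure_display)
    (T : measurableType d) (P : probability T R)
    (V : countType) (e : rel V) (e_sym : symmetric e) (e_irr : irreflexive e)
    (O : T -> rel V) (HO : random_orientation P e O)
    (a b s t : V) (st : s <> t) :
  let A := [set w | in_cluster (O w) t a] in
  let B := [set w | out_cluster (O w) s b] in
  let D := [set w | ~ out_cluster (O w) s t] in
  cond_prob P (A `&` B) D <= cond_prob P A D * cond_prob P B D.
Proof.
set A := [set w | _]; set B := [set w | _]; set D := [set w | _].
have O_or w : orientation e (O w) by case: HO.
pose On n w := restrict (first_edges e n) (O w).
pose reach u v n := [set w | directed_path (On n w) u v].
have reach_mono u v m n : (m <= n)%N -> reach u v m `<=` reach u v n.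
  by move=> mn w; apply: (directed_path_restrict_le e_sym e_irr (O_or w) mn).
have reach_cup u v : [set w | directed_path (O w) u v] = \bigcup_n reach u v n.
  apply/seteqP; split=> w.
    by move=> /(directed_path_restrict e_sym e_irr _ _ (O_or w))[n ?]; exists n.
  case=> n _ uvn; apply/(directed_path_restrict e_sym e_irr _ _ (O_or w)).
  by exists n.
have AE : A = \bigcup_n reach a t n by rewrite -reach_cup.
have BE : B = \bigcup_n reach s b n by rewrite -reach_cup.
have DE : D = \bigcap_n ~` reach s t n.
  by rewrite -setC_bigcup -reach_cup.
have ABE : A `&` B = \bigcup_n (reach a t n `&` reach s b n).
  rewrite AE BE; apply/seteqP; split=> [w [[m _ Am] [n _ Bn]] | w [n _ []]].
    by exists (maxn m n) => //; split;
      [apply: reach_mono Am | apply: reach_mono Bn]; lia.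
  by split; exists n.
have localE n Q := local_probability e_sym HO Q (first_edges_partial_orientation e n).
have mreach u v n : measurable (reach u v n).
  by case: (localE n (fun o => directed_path o u v)).
have cvgD X : (forall n, measurable (X n)) ->
    (forall m n, (m <= n)%N -> X m `<=` X n) ->
    (fun n => fine (P (X n `&` ~` reach s t n))) @ \oo -->
    fine (P (\bigcup_n X n `&` D)).
  move=> mX X_mono; rewrite DE; apply: cvg_probability_cup_cap => // [n | m n mn].
    exact: measurableC.
  exact/subsetC/reach_mono.
have cvg_A := cvgD _ (mreach a t) (reach_mono a t).
have cvg_B := cvgD _ (mreach s b) (reach_mono s b).
have cvg_AB : (fun n => fine (P ((reach a t n `&` reach s b n) `&` ~` reach s t n)))
    @ \oo --> fine (P (A `&` B `&` D)).
  rewrite ABE; apply: cvgD => [n | m n mn]; first exact: measurableI.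
  by apply: setISS; apply: reach_mono.
have cvg_D : (fun n => fine (P (~` reach s t n))) @ \oo --> fine (P D).
  have := cvgD (fun=> setT) (fun=> measurableT) (fun _ _ _ _ => id).
  rewrite bigcup_const // setTI.
  by under eq_fun do rewrite setTI.
rewrite -AE in cvg_A; rewrite -BE in cvg_B.
have PABD : fine (P (A `&` B `&` D)) * fine (P D) <=
    fine (P (A `&` D)) * fine (P (B `&` D)).
  apply: (ler_cvg_to (cvgM cvg_AB cvg_D) (cvgM cvg_A cvg_B)); near=> n.
  have P_count Q : fine (P [set w | Q (On n w)]) =
      2^-1 ^+ size (first_edges e n) * orientation_count (first_edges e n) Q.
    by have [_ /(congr1 fine)] := localE n Q.
  have count_ABD : fine (P (reach a t n `&` reach s b n `&` ~` reach s t n)) = _ :=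
    P_count (fun o => (directed_path o a t /\ directed_path o s b) /\
                      ~ directed_path o s t).
  have count_D : fine (P (~` reach s t n)) = _ :=
    P_count (fun o => ~ directed_path o s t).
  have count_AD : fine (P (reach a t n `&` ~` reach s t n)) = _ :=
    P_count (fun o => directed_path o a t /\ ~ directed_path o s t).
  have count_BD : fine (P (reach s b n `&` ~` reach s t n)) = _ :=
    P_count (fun o => directed_path o s b /\ ~ directed_path o s t).
  rewrite [leLHS](congr2 *%R count_ABD count_D).
  rewrite [leRHS](congr2 *%R count_AD count_BD).
  by rewrite mulrACA [leRHS]mulrACA ler_wpM2l ?orientation_count_le //.
rewrite /cond_prob.
(* Both sides vanish when the conditioning event has probability 0. *)
have [-> | D_neq0] := eqVneq (fine (P D)) 0; first by rewrite invr0 !mulr0.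
have D_gt0 : 0 < fine (P D) by rewrite lt_def D_neq0 fine_ge0.
set q := fine (P D) in PABD D_neq0 D_gt0 *.
rewrite ler_pdivrMr //; set x := fine _; set y := fine _; set z := fine _.
have -> : y / q * (z / q) * q = y * z / q by field.
by rewrite ler_pdivlMr.
Unshelve. all: by end_near. Qed.
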